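(* Let $K>0$ be a constant. If $M\le Kn^2/\log^2 n$ and $p\ge \frac{100\max\{K,1\}\,n}{M}$, then with probability tending to $1$ as $n\to\infty$, $G_{n,p}$ contains a Hamilton cycle $H$ with $\iota(H)\le M$.
   Context: $G_{n,p}$ is the random graph on vertex set $[n]$ in which each of the $\binom n2$ possible edges is present independently with probability $p$. A Hamilton cycle $H$ is treated as the sequence $(i_1=1,i_2,\ldots,i_n)$ of its vertices listed in cyclic order starting from vertex $1$, and $\iota(H)=|\{(k,\ell):k<\ell,\ i_k>i_\ell\}|$ is its number of inversions. *)

(* Defs.v *)
From HB Require Import structures.
From mathcomp Require Export all_boot all_order all_algebra.
From mathcomp Require Export all_classical all_reals all_analysis.

Set Implicit Arguments.
Unset Strict Implicit.
Unset Printing Implicit Defensive.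
Export Order.TTheory GRing.Theory Num.Theory.
Export numFieldNormedType.Exports.
Local Open Scope ring_scope.

(* The vertex set [n] = {1, ..., n} is represented by 'I_n = {0, ..., n-1};
   the shift by one preserves the order, hence inversions, and vertex 1
   becomes 0. A graph on [n] is a set E of edges with E \subset pairs n. *)
Definition pairs (n : nat) : {set {set 'I_n}} :=
  [set e : {set 'I_n} | #|e| == 2%N].

Definition adj (n : nat) (E : {set {set 'I_n}}) : rel 'I_n :=
  fun x y => [set x; y] \in E.

(* G_{n,p} is the product of Bernoulli(p) laws indexed by the pairs. *)
Definition gnp_weight (R : realType) (n : nat) (p : R)
    (E : {set {set 'I_n}}) : R :=
  \prod_(e in pairs n) (if e \in E then p else 1 - p).

Definition gnp_prob (R : realType) (n : nat) (p : R)
    (A : pred {set {set 'I_n}}) : R :=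
  \sum_(E in powerset (pairs n) | A E) gnp_weight p E.

(* For n <= 2 the remaining conditions could be met by a degenerate closed
   walk (a single vertex, or one edge traversed twice). *)
Definition hamilton_cycle (n : nat) (E : {set {set 'I_n}})
    (s : n.-tuple 'I_n) : bool :=
  [&& (2 < n)%N, uniq s, ohead [seq val v | v <- s] == Some 0%N
    & cycle (adj E) s].

Definition inversions (n : nat) (s : n.-tuple 'I_n) : nat :=
  #|[set kl : 'I_n * 'I_n
      | (kl.1 < kl.2)%N && (tnth s kl.2 < tnth s kl.1)%N]|.

Definition has_hamilton_cycle_inv (R : realType) (n : nat) (M : R)
    (E : {set {set 'I_n}}) : bool :=
  [exists s : n.-tuple 'I_n,
    hamilton_cycle E s && ((inversions s)%:R <= M)].

(* Main.v *)
Require Import Defs.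
From mathcomp Require Import all_boot all_order all_algebra.
From mathcomp Require Import all_classical all_reals all_analysis.
From mathcomp Require Import ring lra zify.
From mathcomp Require Import fintype finset.
Set Implicit Arguments.
Unset Strict Implicit.
Unset Printing Implicit Defensive.
Import Order.TTheory GRing.Theory Num.Theory.
Import numFieldNormedType.Exports.
Local Open Scope ring_scope.

(* Expose the edges adaptively.  From the current endpoint move to the smallest
   unvisited neighbour: all inspected pairs are fresh, and a step creates as many
   inversions as there are failures before the first success, so the total number
   of inversions is a sum of n geometric variables and is O(n/p) with probability
   1 - exp(-n).  Stop when a set U of L ~ 48 (log n)/p vertices is left; however
   U is ordered, it adds at most L^2 <= 25 n/p inversions, because
   p n >= 100 (log n)^2.  On U the average degree is of order log n, and Posa
   rotations with fixed starting point finish the job: G_{n,p} is the union of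
   two independent graphs, the first is an expander on U, so either some endpoint
   of a rotated path sees a new vertex or there are at least L/6 endpoints, and
   then the second graph joins one of them to the next vertex (in the end to
   vertex 1) with probability 1 - n^(-4). *)

(** * Product Bernoulli expectations *)

Lemma finset_ind (T : finType) (P : {set T} -> Prop) :
  P set0 -> (forall e (D : {set T}), e \notin D -> P D -> P (e |: D)) ->
  forall D, P D.
Proof.
move=> P0 PU D; elim: {D}#|D| {-2}D (erefl #|D|) => [D /cards0_eq -> //|m IH D Dm].
have /card_gt0P[e eD] : (0 < #|D|)%N by rewrite Dm.
rewrite -(setD1K eD); apply: PU; first by rewrite !inE eqxx.
by apply: IH; move: Dm; rewrite (cardsD1 e) eD => -[].
Qed.

Section Expectation.
Variables (R : realType) (T : finType).
Implicit Types (p : R) (D E : {set T}) (f g : {set T} -> R).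

(** The law of a random subset of [D] with independent coordinates. The ground set varies so that
    exposed pairs can be fixed inside [f] while the others stay random. *)
Definition EX p D f : R :=
  \sum_(E in powerset D) (\prod_(e in D) (if e \in E then p else 1 - p)) * f E.

Lemma EX_set0 p f : EX p set0 f = f set0.
Proof. by rewrite /EX powerset0 big_set1 big_set0 mul1r. Qed.

(** Conditioning on the single coordinate [e]; this recursion drives the inductions over the ground
    set below. *)
Lemma EX_setU1 p D e f : e \notin D ->
  EX p (e |: D) f = p * EX p D (fun E => f (e |: E)) + (1 - p) * EX p D f.
Proof.
move=> eD; rewrite /EX (bigID (fun E : {set T} => e \in E)) /=; congr (_ + _).
  rewrite (reindex_onto (fun E => e |: E) (fun E => E :\ e)) /=; last first.
    by move=> E /andP[_ eE]; rewrite setD1K.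
  rewrite mulr_sumr; apply: eq_big => [E|E].
    rewrite !powersetE setU11 andbT; apply/andP/idP.
      case=> sE /eqP <-; rewrite subDset.
      exact: subset_trans sE _.
    move=> sE; split; first exact: setUS.
    by rewrite setU1K //; apply: contra eD => /(subsetP sE).
  move=> _; rewrite big_setU1 //= setU11 -!mulrA; congr (_ * _).
  congr (_ * _); apply: eq_bigr => i iD; rewrite in_setU1.
  by case: eqP => // ie; rewrite -ie iD in eD.
rewrite mulr_sumr; apply: eq_big => [E|E].
  rewrite !powersetE; apply/andP/idP.
    case=> /subsetP sE eE; apply/subsetP => i iE.
    move: (sE _ iE); rewrite in_setU1 => /orP[/eqP ie|//].
    by rewrite -ie iE in eE.
  move=> sE; split; first by apply: subset_trans sE _; exact: subsetUr.
  by apply: contra eD => /(subsetP sE).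
by case/andP=> _ /negPf eE; rewrite big_setU1 //= eE mulrA.
Qed.

Lemma eq_EX p D f g : f =1 g -> EX p D f = EX p D g.
Proof. by move=> fg; apply: eq_bigr => E _; rewrite fg. Qed.

Lemma EX_cst p D (c : R) : EX p D (fun=> c) = c.
Proof.
elim/finset_ind: D => [|e D eD IH]; first by rewrite EX_set0.
by rewrite EX_setU1 // IH; ring.
Qed.

Lemma EX_D p D f g : EX p D (fun E => f E + g E) = EX p D f + EX p D g.
Proof. by rewrite -big_split; apply: eq_bigr => E _; rewrite mulrDr. Qed.

Lemma EX_Z p D (c : R) f : EX p D (fun E => c * f E) = c * EX p D f.
Proof. by rewrite mulr_sumr; apply: eq_bigr => E _; rewrite mulrCA. Qed.

Lemma EX_sum p D I (r : seq I) (P : pred I) (F : I -> {set T} -> R) :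
  EX p D (fun E => \sum_(i <- r | P i) F i E) = \sum_(i <- r | P i) EX p D (F i).
Proof.
rewrite /EX exchange_big; apply: eq_bigr => E _.
by rewrite mulr_sumr.
Qed.

Lemma ler_EX p D f g : 0 <= p <= 1 ->
  (forall E, E \subset D -> f E <= g E) -> EX p D f <= EX p D g.
Proof.
move=> /andP[p0 p1] fg; apply: ler_sum => E; rewrite powersetE => ED.
apply: ler_wpM2l; last exact: fg.
by apply: prodr_ge0 => i _; case: ifP => _; rewrite ?subr_ge0.
Qed.

(** An element is missed by both independent sets with probability [(1 - p1) * (1 - p2)]. This gives
    the two rounds of exposure. *)
Lemma EX_sprinkle (p1 p2 : R) D f :
  EX (1 - (1 - p1) * (1 - p2)) D f =
  EX p1 D (fun A => EX p2 D (fun B => f (A :|: B))).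
Proof.
elim/finset_ind: D f => [|e D eD IH] f; first by rewrite !EX_set0 setU0.
rewrite !EX_setU1 // !IH.
under [X in _ = p1 * X + _]eq_EX => A do rewrite EX_setU1 //.
under [X in _ = _ + _ * X]eq_EX => A do rewrite EX_setU1 //.
rewrite !EX_D !EX_Z.
have -> : EX p1 D (fun A => EX p2 D (fun B => f (e |: A :|: (e |: B)))) =
  EX p1 D (fun A => EX p2 D (fun B => f (e |: (A :|: B)))).
  by apply: eq_EX => A; apply: eq_EX => B; rewrite -setUUr.
have -> : EX p1 D (fun A => EX p2 D (fun B => f (e |: A :|: B))) =
  EX p1 D (fun A => EX p2 D (fun B => f (e |: (A :|: B)))).
  by apply: eq_EX => A; apply: eq_EX => B; rewrite -setUA.
have -> : EX p1 D (fun A => EX p2 D (fun B => f (A :|: (e |: B)))) =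
  EX p1 D (fun A => EX p2 D (fun B => f (e |: (A :|: B)))).
  by apply: eq_EX => A; apply: eq_EX => B; rewrite setUCA.
by ring.
Qed.

Definition antitone f := forall A B : {set T}, A \subset B -> f B <= f A.

Lemma antitoneU f A : antitone f -> antitone (fun E => f (A :|: E)).
Proof. by move=> af B C BC; apply/af/setUS. Qed.

(** Adding one more random element can only lower the mean of an antitone [f]; so pairs may be
    forgotten whenever an upper bound is wanted. *)
Lemma EX_antitone p D0 D f : 0 <= p <= 1 -> antitone f ->
  D0 \subset D -> EX p D f <= EX p D0 f.
Proof.
move=> p01 af sD; have -> : D = (D :\: D0) :|: D0 by rewrite -[LHS](setID D D0) (setIidPr sD) setUC.
move: (D :\: D0) => X {sD}.
elim/finset_ind: X => [|e X eX IH]; first by rewrite set0U.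
(* [X] has become arbitrary, so [e] may already lie in [D0], and then the ground set does not
   change. *)
rewrite -setUA; have [eXD|eXD] := boolP (e \in X :|: D0).
  by rewrite (setUidPr _) // sub1set.
rewrite EX_setU1 //.
apply: le_trans IH; have [p0 _] := andP p01.
have : EX p (X :|: D0) (fun E => f (e |: E)) <= EX p (X :|: D0) f.
  by apply: ler_EX => // E _; apply/af/subsetUr.
by move=> /(ler_wpM2l p0); lra.
Qed.

(* Expose the pairs of [es] one at a time until the first one is present, and
   forget, by antitonicity, the pairs that were not inspected. *)
Lemma EX_star p D0 D (es : seq T) f : 0 <= p <= 1 -> antitone f ->
  uniq es -> {subset es <= D} -> D0 \subset D -> {in es, forall e, e \notin D0} ->
  EX p D f <=
    \sum_(j < size es) p * (1 - p) ^+ j *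
       EX p D0 (fun E => f ((tnth (in_tuple es) j) |: E))
    + (1 - p) ^+ size es * EX p D0 f.
Proof.
move=> p01 af ues esD D0D esD0.
have [p0 p1] := andP p01.
pose D' := [set:: es] :|: D0.
have D'D : D' \subset D.
  by rewrite subUset D0D andbT; apply/subsetP => e; rewrite inE => /esD.
apply: le_trans (EX_antitone p01 af D'D) _.
clear D'D esD D0D D; rewrite {}/D'.
elim: es ues esD0 => [|e es IH] /=.
  by move=> _ _; rewrite set_nil set0U big_ord0 add0r expr0 mul1r.
move=> /andP[ees ues] esD0.
rewrite set_cons -setUA EX_setU1; last first.
  by rewrite !inE negb_or ees esD0 // mem_head.
rewrite big_ord_recl /= expr0 mulr1 -addrA; apply: lerD.
  apply: ler_wpM2l => //; rewrite (tnth_nth e) /=; apply: EX_antitone => //.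
    exact: antitoneU.
  exact: subsetUr.
have q0 : 0 <= 1 - p by rewrite subr_ge0.
apply: le_trans (ler_wpM2l q0 (IH ues _)) _.
  by move=> x xs; apply: esD0; rewrite inE xs orbT.
rewrite mulrDr mulr_sumr exprS mulrA.
rewrite lerD2r le_eqVlt; apply/orP; left; apply/eqP.
apply: eq_bigr => j _; rewrite !(tnth_nth e) lift0 exprS.
by rewrite !mulrA [p * _]mulrC.
Qed.

Lemma EX_avoid p D (X : {set T}) : 0 <= p <= 1 -> X \subset D ->
  EX p D (fun E => [disjoint E & X]%:R) <= (1 - p) ^+ #|X|.
Proof.
move=> p01 XD; have [p0 p1] := andP p01.
have af : antitone (fun E => [disjoint E & X]%:R).
  move=> A B AB; rewrite ler_nat; case: (boolP [disjoint B & X]) => // BX.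
  by rewrite (disjointWl AB BX).
apply: le_trans (EX_antitone p01 af XD) _ => {XD}.
(* Only the ground set shrinks to [Y] in the induction; the event keeps the full [X]. *)
have {af} : forall Y : {set T}, Y \subset X ->
    EX p Y (fun E => [disjoint E & X]%:R) <= (1 - p) ^+ #|Y|.
  elim/finset_ind => [|e Y eY IH] YX.
    by rewrite cards0 EX_set0 expr0 lern1; case: [disjoint _ & _].
  rewrite EX_setU1 // cardsU1 eY add1n exprS.
  rewrite (_ : EX p Y _ = 0) ?mulr0 ?add0r; last first.
    rewrite -[RHS](EX_cst p Y 0); apply: eq_EX => E; apply/eqP.
    rewrite pnatr_eq0 eqb0 -setI_eq0; apply/set0Pn; exists e.
    by rewrite !inE eqxx (subsetP YX) // setU11.
  by apply: ler_wpM2l; rewrite ?subr_ge0 // IH // (subset_trans _ YX) // subsetUr.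
exact.
Qed.

End Expectation.

Section Geometric.
Variables (R : realType) (T : finType).

Lemma sum_geom (p : R) m : \sum_(j < m) p * (1 - p) ^+ j = 1 - (1 - p) ^+ m.
Proof.
elim: m => [|m IH]; first by rewrite big_ord0 expr0 subrr.
by rewrite big_ord_recr /= IH exprS; ring.
Qed.

(** The weights of the possible first successes add up to at most 1, so together they cost at most
    [c]; if all of [es] fail, [f] is bounded by 1. *)
Lemma EX_star_le (p c : R) (D0 D : {set T}) (es : seq T) (f : {set T} -> R) :
  0 <= p <= 1 -> antitone f -> (forall E, f E <= 1) ->
  uniq es -> {subset es <= D} -> D0 \subset D -> {in es, forall e, e \notin D0} ->
  0 <= c -> {in es, forall e, EX p D0 (fun E => f (e |: E)) <= c} ->
  EX p D f <= c + (1 - p) ^+ size es.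
Proof.
move=> p01 af f1 ues esD D0D esD0 c0 fc; have [p0 p1] := andP p01.
apply: le_trans (EX_star p01 af ues esD D0D esD0) _; apply: lerD.
  apply: (@le_trans _ _ (\sum_(j < size es) p * (1 - p) ^+ j * c)).
    apply: ler_sum => j _; apply: ler_wpM2l.
      by rewrite mulr_ge0 // exprn_ge0 // subr_ge0.
    by apply: fc; exact: mem_tnth.
  rewrite -mulr_suml sum_geom -[leRHS]mul1r ler_wpM2r // gerBl exprn_ge0 //.
  by rewrite subr_ge0.
rewrite -[leRHS]mulr1 ler_wpM2l ?exprn_ge0 ?subr_ge0 //.
by rewrite -[leRHS](EX_cst p D0); apply: ler_EX.
Qed.

End Geometric.

(** * Posa rotations *)

Section Rotations.
Variables (T : finType) (e : rel T).
Hypothesis e_sym : symmetric e.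
Implicit Types (x v t : T) (p q : seq T).

(** Reversing a suffix creates only one new adjacency. The lemma serves both for the graph and for
    the relation inside [uses]. *)
Lemma path_rev_suffix (r : rel T) x c (a b : seq T) : symmetric r ->
  path r x (a ++ rev (c :: b)) =
  [&& path r x a, r (last c b) (last x a) & path r c b].
Proof.
move=> r_sym; rewrite cat_path; congr (_ && _).
rewrite lastI rev_rcons /= r_sym; congr (_ && _).
by rewrite rev_path; apply: eq_path => u v; rewrite r_sym.
Qed.

(* Adjacency of v and t along x :: p, phrased through [path] so that the lemmas
   on concatenation and reversal of paths apply to it. *)
Definition uses x p v t := ~~ path (fun c d => [set c; d] != [set v; t]) x p.

Lemma usesP x p v t : uniq (x :: p) ->
  reflect [/\ v \in x :: p, t \in x :: p &
     index t (x :: p) = (index v (x :: p)).+1 \/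
     index v (x :: p) = (index t (x :: p)).+1] (uses x p v t).
Proof.
move=> u; apply: (iffP idP).
  move/(pathP x) => /existsNP[i]/not_implyP[ip] /negP; rewrite negbK => /eqP vt.
  have iv : index (nth x (x :: p) i) (x :: p) = i by rewrite index_uniq //= ltnW.
  have iv' : index (nth x p i) (x :: p) = i.+1.
    by rewrite -[nth x p i]/(nth x (x :: p) i.+1) index_uniq.
  have m1 : nth x (x :: p) i \in x :: p by apply: mem_nth; rewrite /= ltnW.
  have m2 : nth x p i \in x :: p.
    by rewrite -[nth x p i]/(nth x (x :: p) i.+1); apply: mem_nth.
  have ne : nth x (x :: p) i != nth x p i.
    by apply/eqP => E; move: iv; rewrite E iv'; lia.
  have := set21 v t; rewrite -vt => /set2P vE.
  have := set22 v t; rewrite -vt => /set2P tE.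
  have vt_ne : v != t.
    have := congr1 (fun A : {set T} => #|A|) vt; rewrite !cards2 ne.
    by case: eqP.
  case: vE tE vt_ne => -> [] ->; rewrite ?eqxx // => _; split=> //.
    by left; rewrite iv iv'.
  by right; rewrite iv iv'.
case=> vP tP ivt; apply/negP => /(pathP x) H.
case: ivt => ivt.
  have lt : (index v (x :: p) < size p)%N.
    by rewrite -ltnS -ivt; move: tP; rewrite -index_mem.
  move: (H _ lt); rewrite nth_index // -[nth x p _]/(nth x (x :: p) _.+1) -ivt.
  by rewrite nth_index // eqxx.
have lt : (index t (x :: p) < size p)%N.
  by rewrite -ltnS -ivt; move: vP; rewrite -index_mem.
move: (H _ lt); rewrite nth_index // -[nth x p _]/(nth x (x :: p) _.+1) -ivt.
by rewrite nth_index // setUC eqxx.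
Qed.

(** Posa rotations with [x] fixed: the edge from the endpoint [last c b] to [last x a] replaces the
    one from [last x a] to [c], and [c] becomes the new endpoint. *)
Inductive rotation x p : seq T -> Prop :=
| rotation_refl : rotation x p p
| rotation_step a c b : rotation x p (a ++ c :: b) ->
    e (last c b) (last x a) -> rotation x p (a ++ rev (c :: b)).

Lemma rotation_perm x p q : rotation x p q -> perm_eq q p.
Proof.
elim=> // a c b _ IH _; apply: perm_trans IH.
by rewrite perm_cat2l perm_rev.
Qed.

Lemma rotation_path x p q : path e x p -> rotation x p q -> path e x q.
Proof.
move=> xp; elim=> // a c b _ IH ex; rewrite path_rev_suffix // ex /=.
by move: IH; rewrite cat_path /= => /and3P[-> _ ->].
Qed.

Definition rotation_ends x p : {set T} :=
  [set u | `[< exists2 q, rotation x p q & last x q = u >]].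

(** The only path edge that a rotation destroys contains the new endpoint [c], so an edge whose two
    ends are never endpoints survives all rotations. *)
Lemma rotation_uses x p q v : uniq (x :: p) -> v \notin rotation_ends x p ->
  (forall t, uses x p v t -> t \notin rotation_ends x p) ->
  rotation x p q -> forall t, uses x p v t -> uses x q v t.
Proof.
move=> u vS tS; elim=> // a c b rot IH ex t vt.
have cS : c \in rotation_ends x p.
  rewrite inE; apply/asboolP; exists (a ++ rev (c :: b)).
    exact: rotation_step.
  by rewrite last_cat rev_cons last_rcons.
have := IH _ vt; rewrite /uses path_rev_suffix; last first.
  by move=> y z; rewrite setUC.
rewrite cat_path /= !negb_and => /or3P[->//|/negPn/eqP vc|->]; last by rewrite !orbT.
have : c \in [set v; t] by rewrite -vc set22.
by rewrite !inE => /orP[]/eqP E; subst c; [case/negP: vS|case/negP: (tS _ vt)].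
Qed.

(* Posa's lemma: if neither v nor its two p-neighbours were ever endpoints,
   then v has the same neighbours on every rotated path, so rotating at v
   makes one of them an endpoint. *)
Lemma rotation_ends_neighbour x p u v : uniq (x :: p) -> v \in x :: p ->
  u \in rotation_ends x p -> e u v -> v \notin rotation_ends x p ->
  exists2 t, t \in rotation_ends x p & uses x p v t.
Proof.
move=> up vp uS uv vS; apply: contrapT => /forall2NP H.
have {}H t : uses x p v t -> t \notin rotation_ends x p.
  by move=> vt; case: (H t) => //; move/negP.
move: (uS); rewrite inE => /asboolP[q rot lq].
have Hu := rotation_uses up vS H rot.
have pq := rotation_perm rot.
have uq : uniq (x :: q) by rewrite (perm_uniq (_ : perm_eq _ (x :: p))) ?perm_cons.
have vq : v \in x :: q by rewrite (perm_mem (_ : perm_eq _ (x :: p))) ?perm_cons.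
have end_of q' : rotation x p q' -> index v (x :: q') != size q'.
  move=> rot'; apply: contra vS => /eqP iv; rewrite inE; apply/asboolP.
  exists q' => //; rewrite (last_nth x) -iv nth_index //.
  by rewrite (perm_mem (_ : perm_eq _ (x :: p))) // perm_cons; exact: rotation_perm rot'.
have ltq : (index v (x :: q) < size q)%N.
  by rewrite ltn_neqAle end_of // -ltnS; move: vq; rewrite -index_mem.
have ltp : (index v (x :: p) < size p)%N.
  rewrite ltn_neqAle end_of; last exact: rotation_refl.
  by rewrite -ltnS; move: vp; rewrite -index_mem.
pose w := nth x (x :: q) (index v (x :: q)).+1.
have wq : w \in x :: q by apply: mem_nth.
have iw : index w (x :: q) = (index v (x :: q)).+1 by rewrite index_uniq.
(* The edge from [u] to [v] allows reversing the suffix that starts at the successor [w] of [v],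
   which makes [w] an endpoint. *)
have wS : w \in rotation_ends x p.
  rewrite inE; apply/asboolP.
  have [i iE] : exists i, i = index v (x :: q) by exists (index v (x :: q)).
  have iq : (i < size q)%N by rewrite iE.
  have qE : q = take i q ++ w :: drop i.+1 q.
    by rewrite /w -iE -[nth x (x :: q) _]/(nth x q i) -drop_nth // cat_take_drop.
  exists (take i q ++ rev (w :: drop i.+1 q)); last first.
    by rewrite last_cat rev_cons last_rcons.
  apply: rotation_step; first by rewrite -qE.
  have -> : last w (drop i.+1 q) = u by rewrite -lq [in RHS]qE last_cat.
  have -> // : last x (take i q) = v.
  rewrite (last_nth x) size_takel ?(ltnW iq) //.
  have <- : nth x (x :: q) i = v by rewrite iE nth_index.
  by case: (i) => //= j; rewrite nth_take.
(* The [p]-neighbours of [v] are still its neighbours on [q]. If none of them is [w], each is the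
   predecessor of [v] on [q]; then [v] is not [x], and its two distinct [p]-neighbours [t1] and [t2]
   coincide, a contradiction. *)
suff : uses x p v w by move/H; rewrite wS.
pose t2 := nth x (x :: p) (index v (x :: p)).+1.
have t2p : t2 \in x :: p by apply: mem_nth.
have it2 : index t2 (x :: p) = (index v (x :: p)).+1 by rewrite index_uniq.
have use2 : uses x p v t2 by apply/usesP => //; split=> //; left.
have [_ t2q it2q] := usesP v t2 uq (Hu _ use2).
case: it2q => it2q.
  suff <- : t2 = w by [].
  by rewrite -(nth_index x t2q) it2q.
case iv : (index v (x :: p)) => [|k].
  have vx : v = x by rewrite -(nth_index x vp) iv.
  by move: it2q; rewrite vx /= eqxx.
pose t1 := nth x (x :: p) k.
have kp : (k < size (x :: p))%N by rewrite iv in ltp; rewrite /= ltnS; exact: ltnW (ltnW ltp).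
have t1p : t1 \in x :: p by apply: mem_nth.
have it1 : index t1 (x :: p) = k by rewrite index_uniq.
have use1 : uses x p v t1 by apply/usesP => //; split=> //; right; rewrite iv it1.
have [_ t1q it1q] := usesP v t1 uq (Hu _ use1).
case: it1q => it1q.
  suff <- : t1 = w by [].
  by rewrite -(nth_index x t1q) it1q.
have E : t1 = t2.
  rewrite -(nth_index x t1q) -(nth_index x t2q).
  by congr nth; move: it1q; rewrite it2q => -[].
by move: it2; rewrite -E it1 iv => /(congr1 (leq^~ k.+1)); rewrite leqnSn ltnn.
Qed.

(** By Posa's lemma every such [v] is the successor or the predecessor along [p] of some endpoint.
    The default values of [nx] and [pv] at the two ends of the path are harmless, as only the sizes
    of the images are bounded. *)
Lemma card_rotation_ends_nbhd x p : uniq (x :: p) ->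
  (#|[set v in x :: p | v \notin rotation_ends x p &
      [exists u in rotation_ends x p, e u v]]| <= 2 * #|rotation_ends x p|)%N.
Proof.
move=> up; set S := rotation_ends x p.
pose nx t := nth x (x :: p) (index t (x :: p)).+1.
pose pv t := nth x (x :: p) (index t (x :: p)).-1.
apply: (@leq_trans #|(nx @: S) :|: (pv @: S)|).
  apply/subset_leq_card/subsetP => v.
  rewrite inE => /and3P[vp vS /existsP[u /andP[uS uv]]].
  have [t tS /(usesP _ _ up)[_ tp itv]] := rotation_ends_neighbour up vp uS uv vS.
  rewrite inE; case: itv => itv; apply/orP; [right|left]; apply/imsetP; exists t => //.
    by rewrite /pv itv /= nth_index.
  by rewrite /nx -itv nth_index.
apply: leq_trans (leq_card_setU _ _) _.
by rewrite mul2n -addnn leq_add // leq_imset_card.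
Qed.

Lemma rotation_endsP x p u : path e x p -> u \in rotation_ends x p ->
  exists q, [/\ perm_eq q p, path e x q & last x q = u].
Proof.
rewrite inE => xp /asboolP[q rot lq]; exists q; split=> //.
  exact: rotation_perm rot.
exact: rotation_path xp rot.
Qed.

Lemma rotation_ends_sub x p : {subset rotation_ends x p <= x :: p}.
Proof.
move=> u; rewrite inE => /asboolP[q rot <-].
by have := mem_last x q; rewrite !inE (perm_mem (rotation_perm rot)).
Qed.

Lemma mem_rotation_ends x p : last x p \in rotation_ends x p.
Proof. by rewrite inE; apply/asboolP; exists p => //; exact: rotation_refl. Qed.

End Rotations.

(** * Rotation and extension in a random graph *)

Section Graph.
Variable n : nat.
Implicit Types (x y z u v w : 'I_n) (U V W S : {set 'I_n}) (E : {set {set 'I_n}}).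

Definition inside V : {set {set 'I_n}} := [set e in pairs n | e \subset V].

Lemma insideS V W : V \subset W -> inside V \subset inside W.
Proof.
move=> VW; apply/subsetP => e; rewrite !inE => /andP[-> eV].
exact: subset_trans eV VW.
Qed.

Lemma edge_inside x y V : x != y -> x \in V -> y \in V -> [set x; y] \in inside V.
Proof. by move=> xy xV yV; rewrite !inE cards2 xy subUset !sub1set xV yV. Qed.

Lemma adj_sym E : symmetric (adj E).
Proof. by move=> x y; rewrite /adj setUC. Qed.

Lemma adjS E E' : E \subset E' -> subrel (adj E) (adj E').
Proof. by move=> EE' x y; rewrite /adj; move/subsetP: EE'; apply. Qed.

Lemma set2_injr w v v' : v != w -> [set w; v] = [set w; v'] -> v = v'.
Proof.
move=> vw eq; have : v \in [set w; v'] by rewrite -eq set22.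
by rewrite !inE (negPf vw) => /eqP.
Qed.

Lemma uniq_star w (s : seq 'I_n) :
  uniq s -> w \notin s -> uniq [seq [set w; v] | v <- s].
Proof.
move=> us ws; rewrite map_inj_in_uniq // => v v' vs _.
by apply: set2_injr; apply: contraNneq ws => <-.
Qed.

Fixpoint inv_seq (s : seq 'I_n) : nat :=
  if s is x :: s' then (count (fun y => (y < x)%N) s' + inv_seq s')%N else 0%N.

Lemma inv_seq_le s : (inv_seq s <= size s ^ 2)%N.
Proof.
elim: s => //= x s IH; have := count_size (fun y => (y < x)%N) s.
by move: IH; rewrite -!mulnn; nia.
Qed.

(** [enum U] is increasing, so smaller elements can only stand at the first [j] positions. This
    prices a greedy step that skips [j] vertices. *)
Lemma count_lt_enum U j x : (j < #|U|)%N ->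
  (count (fun v => (v < nth x (enum U) j)%N) (enum U) <= j)%N.
Proof.
move=> jU; rewrite cardE in jU.
have srt : sorted ltn (map val (enum U)).
  rewrite /enum_mem -enumT /=; apply: (subseq_sorted ltn_trans).
    by apply: map_subseq; exact: filter_subseq.
  by rewrite val_enum_ord; exact: iota_ltn_sorted.
rewrite -{2}(cat_take_drop j (enum U)) count_cat.
rewrite (_ : count _ (drop _ _) = 0%N) ?addn0.
  by apply: leq_trans (count_size _ _) _; rewrite size_take jU.
apply/eqP; rewrite -leqn0 leqNgt -has_count; apply/hasPn => v /(nthP x)[i].
rewrite size_drop ltn_subRL => ilt <-; rewrite nth_drop -leqNgt.
rewrite -!(nth_map x 0%N val) //.
apply: (sorted_leq_nth leq_trans leqnn) => //; rewrite ?inE ?size_map ?leq_addr //.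
by apply: sub_sorted srt => a b; exact: ltnW.
Qed.

(** The factor 2 is that of [card_rotation_ends_nbhd]: a set of endpoints with no neighbour off the
    path violates the inequality, hence exceeds a sixth of [V]. *)
Definition expander E V : Prop := forall S, S \subset V -> S != set0 ->
  (6 * #|S| <= #|V|)%N ->
  (2 * #|S| < #|[set v in V | v \notin S & [exists u in S, adj E u v]]|)%N.

Lemma expanderS E E' V : E \subset E' -> expander E V -> expander E' V.
Proof.
move=> EE' H S SV S0 S6; apply: leq_trans (H S SV S0 S6) _.
apply/subset_leq_card/subsetP => v; rewrite !inE => /and3P[-> -> /existsP[u]] /=.
by case/andP=> uS uv; apply/existsP; exists u; rewrite uS (adjS EE' uv).
Qed.

Lemma expander_rotation_ends E V x q : expander E V -> uniq (x :: q) ->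
  {subset x :: q <= V} ->
  (forall u v, u \in rotation_ends (adj E) x q -> v \in V -> adj E u v ->
     v \in x :: q) ->
  (#|V| < 6 * #|rotation_ends (adj E) x q|)%N.
Proof.
set S := rotation_ends _ _ _ => expE uq qV clS; rewrite ltnNge; apply/negP => S6.
have SV : S \subset V by apply/subsetP => u /rotation_ends_sub/qV.
have S0 : S != set0 by apply/set0Pn; exists (last x q); exact: mem_rotation_ends.
have := expE S SV S0 S6; apply/negP; rewrite -leqNgt.
apply: leq_trans (card_rotation_ends_nbhd (adj E) uq).
apply/subset_leq_card/subsetP => v; rewrite !inE => /and3P[vV -> /= uS].
rewrite uS andbT -in_cons; case/existsP: uS => u /andP[uS uv].
exact: clS uS vV uv.
Qed.

Section Extension.
Variables (R : realType) (z : 'I_n).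

(** The part of the Hamilton cycle still to be built: from the current endpoint [x] through all of
    [U] and back to [z]. The budget [T] covers inversions within [U] only; those with visited
    vertices are charged when these are visited. *)
Definition ham_ext x U (T : R) E : bool :=
  `[< exists s, [/\ perm_eq s (enum U), path (adj E) x s, adj E (last x s) z &
      (inv_seq s)%:R <= T] >].

Definition bad x U (T : R) E : R := (~~ ham_ext x U T E)%:R.

Lemma bad_le1 x U T E : bad x U T E <= 1.
Proof. by rewrite /bad lern1; case: ham_ext. Qed.

Lemma ham_extS x U T E E' : E \subset E' -> ham_ext x U T E -> ham_ext x U T E'.
Proof.
move=> EE' /asboolP[s [sU xs sz sT]]; apply/asboolP; exists s; split=> //.
  exact: sub_path (adjS EE') _ _ xs.
exact: adjS EE' _ _ sz.
Qed.

Lemma bad_antitone x U T : antitone (bad x U T).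
Proof.
move=> E E' EE'; rewrite /bad ler_nat.
by case: (boolP (ham_ext x U T E)) => [/(ham_extS EE') -> //|_]; case: (~~ _).
Qed.

(* For a path in V missing exactly W, the pairs not exposed so far; z is the
   vertex to which the path has to return. *)
Definition touch (V W : {set 'I_n}) : {set {set 'I_n}} :=
  [set e in inside (z |: V) | ~~ [disjoint e & z |: W]].

Lemma touchS V W W' : W \subset W' -> touch V W \subset touch V W'.
Proof.
move=> WW'; apply/subsetP => e; rewrite !inE => /andP[-> /=].
by apply: contra => /disjointWr; apply; apply: setUS.
Qed.

Section Phase2.
Variables (p eta T : R) (x : 'I_n) (U : {set 'I_n}).
Hypothesis p01 : 0 <= p <= 1.
Hypothesis zV : z \notin x |: U.
Hypothesis xU : x \notin U.
Hypothesis eta_ge : forall k, (#|x |: U| < 6 * k)%N -> (1 - p) ^+ k <= eta.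
Hypothesis T_ge : (#|U| ^ 2)%:R <= T.

(** Induction on the number of vertices of [U] missing from the path; [E] collects the edges known
    so far. Each absorption of a missing vertex, and the final return to [z], fails with probability
    at most [eta], because more than a sixth of [x |: U] are available endpoints. *)
Lemma EX_bad_expander E q : expander E (x |: U) -> uniq (x :: q) ->
  path (adj E) x q -> {subset q <= U} ->
  EX p (touch (x |: U) (U :\: [set:: q])) (fun B => bad x U T (E :|: B)) <=
  (#|U :\: [set:: q]|.+1)%:R * eta.
Proof.
have [p0 p1] := andP p01.
have eta0 : 0 <= eta.
  (* Any admissible [k] will do here. *)
  apply: le_trans (eta_ge (k := #|x |: U|.+1) _); last by lia.
  by rewrite exprn_ge0 // subr_ge0.
move Em : #|U :\: [set:: q]| => m.
elim: m E q Em => [|m IH] E q Em expE uq xq qU.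
all: pose S := rotation_ends (adj E) x q.
all: have SP u (uS : u \in S) := rotation_endsP (@adj_sym E) xq uS.
all: have Sq u (uS : u \in S) : u \in x :: q := rotation_ends_sub uS.
all: have qV : {subset x :: q <= x |: U}
  by move=> u; rewrite !inE => /orP[->//|/qU ->]; rewrite orbT.
all: have SzD w (wq : w \notin x :: q) : uniq [seq [set w; v] | v <- enum S]
  by apply: uniq_star (enum_uniq _) _; rewrite mem_enum; apply: contra wq; exact: Sq.
- have Uq : {subset U <= q}.
    move=> v vU; move/cards0_eq/setP/(_ v): Em; rewrite !inE vU andbT.
    by move/negbFE.
  have zq : z \notin x :: q.
    by apply: contra zV; rewrite !inE => /orP[->//|/qU ->]; rewrite orbT.
  (* With nothing missing, a single edge from an endpoint to [z] closes the cycle, so success leaves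
     failure probability 0. *)
  have -> : (1%:R : R) * eta = 0 + eta by rewrite mul1r add0r.
  have big_S : (1 - p) ^+ #|S| <= eta.
    apply: eta_ge; apply: expander_rotation_ends => // u v _.
    by rewrite !inE => /orP[->//|/Uq ->]; rewrite orbT.
  apply: le_trans (lerD (lexx 0) big_S).
  rewrite cardE -(size_map (fun v => [set z; v])).
  apply: (@EX_star_le _ _ p 0 set0) => //.
  + by apply: antitoneU; exact: bad_antitone.
  + by move=> B; exact: bad_le1.
  + exact: SzD.
  + move=> e /mapP[v]; rewrite mem_enum => vS ->.
    have vz : z != v by apply: contraNneq zq => ->; exact: Sq.
    rewrite inE edge_inside ?setU11 //=; last first.
      by rewrite inE (qV _ (Sq _ vS)) orbT.
    rewrite -setI_eq0; apply/set0Pn; exists z.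
    by rewrite !inE eqxx.
  + exact: sub0set.
  + by move=> e _; rewrite inE.
  + move=> e /mapP[v]; rewrite mem_enum => vS ->.
    rewrite EX_set0 setU0 /bad.
    suff -> : ham_ext x U T (E :|: [set [set z; v]]) by [].
    have [q' [qq' xq' lq']] := SP _ vS.
    have uq' : uniq q' by rewrite (perm_uniq qq'); case/andP: uq.
    apply/asboolP; exists q'; split.
    * apply: uniq_perm => //; first exact: enum_uniq.
      move=> t; rewrite mem_enum (perm_mem qq'); apply/idP/idP => [/qU|/Uq] //.
    * by apply: sub_path xq'; apply: adjS; exact: subsetUl.
    * by rewrite lq' /adj !inE [[set v; z]]setUC eqxx orbT.
    * apply: le_trans T_ge; rewrite ler_nat; apply: leq_trans (inv_seq_le _) _.
      rewrite leq_exp2r // cardE uniq_leq_size // => t.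
      by rewrite mem_enum (perm_mem qq') => /qU.
(* Rotate until [u] is the endpoint, append [w], and use induction for the longer path. *)
- have ext w u E' : E \subset E' -> u \in S -> adj E' u w -> w \in U -> w \notin q ->
    EX p (touch (x |: U) ((U :\: [set:: q]) :\ w)) (fun B => bad x U T (E' :|: B)) <=
    m.+1%:R * eta.
    move=> EE' uS uw wU wq; have [q' [qq' xq' lq']] := SP _ uS.
    have Wq : U :\: [set:: rcons q' w] = (U :\: [set:: q]) :\ w.
      by apply/setP => t; rewrite !inE mem_rcons inE (perm_mem qq') negb_or andbA.
    rewrite -Wq; apply: IH.
    + by rewrite Wq; move: Em; rewrite (cardsD1 w) !inE wq wU => -[].
    + exact: expanderS expE.
    + have xqq' : perm_eq (x :: q') (x :: q) by rewrite perm_cons.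
      rewrite -rcons_cons rcons_uniq (perm_mem xqq') (perm_uniq xqq') uq andbT.
      by rewrite inE (negPf wq) orbF; apply: contraNneq xU => <-.
    + by rewrite rcons_path lq' uw andbT; apply: sub_path xq'; apply: adjS.
    + by move=> t; rewrite mem_rcons inE (perm_mem qq') => /orP[/eqP->//|/qU].
  (* If a known edge already leaves the set of endpoints for a missing vertex, the path is extended
     without exposing anything. *)
  have [[w [u [uS wU wq uw]]]|noext] := pselect (exists w u,
      [/\ u \in S, w \in U, w \notin q & adj E u w]).
    apply: (@le_trans _ _ (m.+1%:R * eta)); last by rewrite ler_wpM2r // ler_nat.
    apply: le_trans (ext w u E _ uS uw wU wq) => //.
    apply: EX_antitone => //; first by apply: antitoneU; exact: bad_antitone.
    by apply: touchS; exact: subsetDl.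
  (* Otherwise the endpoints are numerous by expansion, and the pairs from an arbitrary missing [w]
     to all of them are exposed. *)
  have /card_gt0P[w] : (0 < #|U :\: [set:: q]|)%N by rewrite Em.
  rewrite !inE => /andP[wq wU].
  have wxq : w \notin x :: q.
    by rewrite inE (negPf wq) orbF; apply: contraNneq xU => <-.
  have wz : w != z by apply: contraNneq zV => <-; rewrite !inE wU orbT.
  have -> : (m.+2%:R : R) * eta = m.+1%:R * eta + eta by rewrite -natr1; ring.
  have big_S : (1 - p) ^+ #|S| <= eta.
    apply: eta_ge; apply: expander_rotation_ends => // u v uS vV uv.
    apply: contrapT => /negP; rewrite inE negb_or => /andP[vx vq].
    move: vV; rewrite !inE (negPf vx) /= => vU.
    by apply: noext; exists v, u.
  apply: le_trans (lerD (lexx _) big_S).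
  rewrite cardE -(size_map (fun v => [set w; v])).
  apply: (@EX_star_le _ _ p _ (touch (x |: U) ((U :\: [set:: q]) :\ w))) => //.
  + by apply: antitoneU; exact: bad_antitone.
  + by move=> B; exact: bad_le1.
  + exact: SzD.
  + move=> e /mapP[v]; rewrite mem_enum => vS ->.
    have vw : w != v by apply: contraNneq wxq => ->; exact: Sq.
    rewrite inE edge_inside //=; last 2 first.
      by rewrite !inE wU !orbT.
      by rewrite inE (qV _ (Sq _ vS)) orbT.
    rewrite -setI_eq0; apply/set0Pn; exists w.
    by rewrite !inE eqxx wq wU orbT.
  + by apply: touchS; exact: subsetDl.
  (* Freshness: once [w] is on the path, neither [w] nor [v] is [z] or missing, so their pair is not
     reserved for later steps. *)
  + move=> e /mapP[v]; rewrite mem_enum => vS ->.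
    rewrite inE negb_and negbK; apply/orP; right.
    rewrite -setI_eq0; apply/eqP/setP => t; rewrite !inE.
    have := Sq _ vS; rewrite inE => vxq.
    case: eqP => [-> |_] /=; first by rewrite (negPf wz).
    case: eqP => [-> |_] //=.
    have -> /= : v == z = false.
      apply/negbTE; apply: contraNneq zV => <-.
      exact/qV/Sq.
    case/orP: vxq => [/eqP->|->]; last by rewrite ?andbF.
    by rewrite (negPf xU) ?andbF.
  + by rewrite mulr_ge0.
  + move=> e /mapP[v]; rewrite mem_enum => vS ->.
    have vw : adj (E :|: [set [set w; v]]) v w.
      by rewrite /adj (setUC [set v]) !inE eqxx orbT.
    apply: le_trans (ext w v _ (subsetUl _ _) vS vw wU wq).
    by rewrite le_eqVlt; apply/orP; left; apply/eqP/eq_EX => B; rewrite setUA.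
Qed.

End Phase2.
End Extension.
End Graph.

(** * Greedy phase *)

Section Greedy.
Variables (R : realType) (n : nat) (z : 'I_n) (p1 p2 lam eta eps : R) (L : nat).
Variable D1 : {set {set 'I_n}}.
Implicit Types (x y : 'I_n) (U : {set 'I_n}) (T : R).
Hypothesis p1_01 : 0 <= p1 <= 1.
Hypothesis p2_01 : 0 <= p2 <= 1.
Hypothesis lam0 : 0 <= lam.
Hypothesis eta0 : 0 <= eta.
Hypothesis eps0 : 0 <= eps.
Hypothesis geom_mgf : forall m,
  \sum_(j < m) p2 * (1 - p2) ^+ j * expR (lam * j%:R) <= 4.
Hypothesis eta_ge : forall k, (L.+1 < 6 * k)%N -> (1 - p2) ^+ k <= eta.
Hypothesis expander_whp : forall x U, #|U| = L -> x \notin U -> z \notin x |: U ->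
  EX p1 D1 (fun A => (~~ `[< expander A (x |: U) >])%:R) <= eps.

(* The graph A of density p1 is only inspected once U has shrunk to L vertices. *)
Definition bad_prob x U T : R :=
  EX p1 D1 (fun A => EX p2 (inside (z |: (x |: U))) (fun B => bad z x U T (A :|: B))).

(** Visiting [y] first creates inversions only with the smaller elements of [U], at most [j] in
    number. *)
Lemma ham_ext_cons x U T (E B : {set {set 'I_n}}) j : (j < #|U|)%N ->
  let y := nth x (enum U) j in
  ham_ext z y (U :\ y) (T - j%:R) (E :|: B) ->
  ham_ext z x U T (E :|: ([set x; y] |: B)).
Proof.
move=> jU y /asboolP[s [sU ys sz sT]].
have yU : y \in U by rewrite -mem_enum mem_nth // -cardE.
have BB : E :|: B \subset E :|: ([set x; y] |: B) by rewrite setUS // subsetUr.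
have sUy : perm_eq (y :: s) (enum U).
  rewrite (perm_trans (_ : perm_eq _ (y :: enum (U :\ y)))) ?perm_cons //.
  apply: uniq_perm => [||t]; rewrite ?enum_uniq //=.
    by rewrite enum_uniq andbT mem_enum !inE eqxx.
  by rewrite inE !mem_enum !inE; case: eqP => // ->.
apply/asboolP; exists (y :: s); split=> //=.
- apply/andP; split; first by rewrite /adj !inE eqxx orbT.
  exact: sub_path (adjS BB) _ _ ys.
- exact: adjS BB _ _ sz.
- rewrite natrD; move: sT; rewrite lerBrDl; apply: le_trans; rewrite lerD2r ler_nat.
  apply: leq_trans (count_lt_enum x jU); rewrite -/y.
  by move/permP: sUy => /(_ (fun v => (v < y)%N)) <-; rewrite /= leq_addl.
Qed.

(** Either the first graph fails to expand, at cost [eps], or rotation and extension start from the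
    path reduced to [x]; any order of the [L] vertices respects the budget. *)
Lemma bad_prob_greedy_base x U T : #|U| = L -> x \notin U -> z \notin x |: U ->
  (L ^ 2)%:R <= T -> bad_prob x U T <= eps + L.+1%:R * eta.
Proof.
move=> UL xU zV LT; rewrite -[X in _ + X](EX_cst p1 D1).
apply: (le_trans _ (lerD (expander_whp UL xU zV) (lexx _))).
rewrite -EX_D; apply: ler_EX => // A _; case: asboolP => [expA|nexpA] /=; last first.
  apply: (@le_trans _ _ 1); last by rewrite lerDl mulr_ge0.
  by rewrite -[leRHS](EX_cst p2 (inside (z |: (x |: U)))); apply: ler_EX => // *; exact: bad_le1.
have Heta k : (#|x |: U| < 6 * k)%N -> (1 - p2) ^+ k <= eta.
  by rewrite cardsU1 xU add1n UL; exact: eta_ge.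
have LT' : (#|U| ^ 2)%:R <= T by rewrite UL.
have := @EX_bad_expander _ _ _ p2 eta T x U p2_01 zV xU Heta LT' A [::] expA isT isT.
rewrite set_nil setD0 add0r -UL => H.
apply: le_trans (H _) => //; apply: EX_antitone => //.
  by apply: antitoneU; exact: bad_antitone.
by apply/subsetP => e; rewrite !inE => /andP[].
Qed.

Lemma bad_prob_le1 x U T : bad_prob x U T <= 1.
Proof.
rewrite -[leRHS](EX_cst p1 D1); apply: ler_EX => // A _.
rewrite -[leRHS](EX_cst p2 (inside (z |: (x |: U)))); apply: ler_EX => // B _.
exact: bad_le1.
Qed.

(** An exponential moment argument run through the induction: each greedy step multiplies the first
    term by at most 4, the bound of [geom_mgf], and adds the probability that the endpoint has no
    neighbour among at least [L] vertices. *)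
Lemma bad_prob_greedy u x U T : #|U| = (L + u)%N -> x \notin U -> z \notin x |: U ->
  bad_prob x U T <= 4 ^+ u * expR (lam * ((L ^ 2)%:R - T))
    + u%:R * (1 - p2) ^+ L + (eps + L.+1%:R * eta).
Proof.
have [p20 p21] := andP p2_01.
have q0 : 0 <= 1 - p2 by rewrite subr_ge0.
elim: u x U T => [|u IH] x U T Uu xU zV.
  rewrite addn0 in Uu; rewrite expr0 mul1r mul0r addr0.
  have [LT|TL] := leP (L ^ 2)%:R T.
    by apply: le_trans (bad_prob_greedy_base Uu xU zV LT) _; rewrite lerDr expR_ge0.
  (* If the budget is below [L ^ 2], the exponential is at least 1 and the bound is trivial. *)
  apply: le_trans (bad_prob_le1 _ _ _) _.
  rewrite -[leLHS]addr0 lerD //; last by rewrite addr_ge0 // mulr_ge0.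
  by rewrite -[leLHS]expR0 ler_expR mulr_ge0 // subr_ge0 ltW.
pose es := [seq [set x; y] | y <- enum U].
have es_size : size es = #|U| by rewrite size_map -cardE.
have esE (j : 'I_(size es)) : tnth (in_tuple es) j = [set x; nth x (enum U) j].
  by rewrite (tnth_nth set0) /= (nth_map x) // -cardE -es_size.
have zU : z \notin U by apply: contra zV; rewrite !inE => ->; rewrite orbT.
have zx : z != x by apply: contraNneq zV => ->; rewrite !inE eqxx.
(* The pairs from [x] to [U] are inspected in increasing order of the second vertex; those inside
   [z |: U] remain fresh for the later steps. *)
have star A : EX p2 (inside (z |: (x |: U))) (fun B => bad z x U T (A :|: B)) <=
    \sum_(j < size es) p2 * (1 - p2) ^+ j * EX p2 (inside (z |: U))
       (fun B => bad z (nth x (enum U) j) (U :\ nth x (enum U) j) (T - j%:R) (A :|: B))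
    + (1 - p2) ^+ L.
  apply: (@le_trans _ _ _ _ _ (@EX_star _ _ p2 (inside (z |: U)) _ es _ _ _ _ _ _ _)) => //.
  - by apply: antitoneU; exact: bad_antitone.
  - by apply: uniq_star (enum_uniq _) _; rewrite mem_enum.
  - move=> e /mapP[y]; rewrite mem_enum => yU ->; apply: edge_inside.
    + by apply: contraNneq xU => ->.
    + by rewrite !inE eqxx orbT.
    + by rewrite !inE yU !orbT.
  - by apply: insideS; rewrite setUS // subsetUr.
  - move=> e /mapP[y _ ->]; rewrite inE negb_and; apply/orP; right.
    by rewrite subUset !sub1set !inE (negPf xU) orbF eq_sym (negPf zx).
  apply: lerD.
    apply: ler_sum => j _; apply: ler_wpM2l; first by rewrite mulr_ge0 // exprn_ge0.
    apply: ler_EX => // B _; rewrite esE /bad ler_nat.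
    have jU : (j < #|U|)%N by rewrite -es_size.
    have [/(ham_ext_cons jU) -> //|_] :=
      boolP (ham_ext z (nth x (enum U) j) (U :\ nth x (enum U) j) (T - j%:R) (A :|: B)).
    by case: (~~ _).
  apply: (@le_trans _ _ ((1 - p2) ^+ size es)).
    rewrite -[leRHS]mulr1; apply: ler_wpM2l; first by rewrite exprn_ge0.
    rewrite -[leRHS](EX_cst p2 (inside (z |: U))); apply: ler_EX => // *; exact: bad_le1.
  rewrite es_size Uu; apply: ler_wiXn2l => //; last by rewrite leq_addr.
  by rewrite gerBl.
apply: (le_trans (ler_EX p1_01 (fun A _ => star A))).
rewrite EX_D EX_cst EX_sum.
set c : R := u%:R * (1 - p2) ^+ L + (eps + L.+1%:R * eta).
have c0 : 0 <= c by rewrite !addr_ge0 // mulr_ge0 // exprn_ge0.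
set a := 4 ^+ u * expR (lam * ((L ^ 2)%:R - T)).
have a0 : 0 <= a by rewrite mulr_ge0 ?expR_ge0 // exprn_ge0.
apply: (@le_trans _ _ (\sum_(j < size es) (a * (p2 * (1 - p2) ^+ j * expR (lam * j%:R))
     + c * (p2 * (1 - p2) ^+ j)) + (1 - p2) ^+ L)).
  rewrite lerD2r; apply: ler_sum => j _; rewrite EX_Z.
  have jU : (j < #|U|)%N by rewrite -es_size.
  set y := nth x (enum U) j.
  have yU : y \in U by rewrite -mem_enum mem_nth // -cardE.
  have := IH y (U :\ y) (T - j%:R).
  rewrite /bad_prob setD1K // => H.
  rewrite [a * _]mulrCA -[c * _]mulrC -mulrDr.
  apply: ler_wpM2l; first by rewrite mulr_ge0 // exprn_ge0.
  apply: le_trans (H _ _ _) _.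
  - by move: Uu; rewrite (cardsD1 y) yU addnS => -[].
  - by rewrite !inE eqxx.
  - by [].
  - rewrite -addrA lerD2r /a -mulrA -expRD le_eqVlt; apply/orP; left; apply/eqP.
    by congr (_ * expR _); ring.
rewrite big_split /= -mulr_sumr -[X in _ + X + _ <= _]mulr_sumr sum_geom.
have -> : 4 ^+ u.+1 * expR (lam * ((L ^ 2)%:R - T)) + u.+1%:R * (1 - p2) ^+ L
  + (eps + L.+1%:R * eta) = a * 4 + c * 1 + (1 - p2) ^+ L.
  by rewrite /a /c exprS -natr1; ring.
rewrite lerD2r; apply: lerD; apply: ler_wpM2l => //; first exact: geom_mgf.
by rewrite gerBl exprn_ge0.
Qed.

End Greedy.

(** * Expansion of sparse random graphs *)

Lemma bin_le_exp n k : ('C(n, k) <= n ^ k)%N.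
Proof.
elim: n k => [|n IH] [|k]; rewrite ?bin0 ?bin0n ?expn0 //.
rewrite binS; apply: leq_trans (leq_add (IH _) (IH _)) _.
rewrite expnSr -mulnSr expnSr leq_mul2r; apply/orP; right.
by case: k => [|k]; rewrite ?expn0 // leq_exp2r.
Qed.

(** Sets of a given size [s > 0] contribute at most [(n * rho) ^ s], hence at most [n * rho], and
    there are [n] such sizes. *)
Lemma sum_expr_card (R : realType) n (rho : R) : 0 <= rho -> n%:R * rho <= 1 ->
  \sum_(S : {set 'I_n} | S != set0) rho ^+ #|S| <= n%:R ^+ 2 * rho.
Proof.
move=> r0 nr1.
rewrite (partition_big (fun S : {set 'I_n} => inord #|S| : 'I_n.+1)
  (fun s => s != ord0)) /=; last first.
  move=> S S0; apply: contraNneq S0 => /(congr1 val) /=.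
  rewrite inordK; last by rewrite ltnS -[leqRHS]card_ord max_card.
  by move/cards0_eq/eqP.
have card_le (S : {set 'I_n}) : (#|S| < n.+1)%N.
  by rewrite ltnS -[leqRHS]card_ord max_card.
rewrite big_mkcond /= big_ord_recl /= add0r.
apply: (@le_trans _ _ (\sum_(s < n) n%:R * rho)); last first.
  by rewrite sumr_const card_ord expr2 -mulrA [leRHS]mulr_natl.
apply: ler_sum => s _.
apply: (@le_trans _ _ (\sum_(S : {set 'I_n} | #|S| == s.+1) rho ^+ s.+1)).
  rewrite le_eqVlt; apply/orP; left; apply/eqP.
  apply: eq_big => [S|S /andP[_ /eqP]].
    apply/andP/eqP => [[_ /eqP/(congr1 val)]|Ss]; first by rewrite /= inordK.
    by split; [rewrite -card_gt0 Ss|apply/eqP/val_inj; rewrite /= inordK // Ss].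
  by move=> /(congr1 val); rewrite /= inordK // => ->.
rewrite sumr_const -(cardsE (fun S : {set 'I_n} => #|S| == s.+1)) card_draws card_ord.
rewrite -[leLHS]mulr_natl.
apply: (@le_trans _ _ ((n%:R * rho) ^+ s.+1)).
  rewrite exprMn ler_wpM2r ?exprn_ge0 // -natrX ler_nat; exact: bin_le_exp.
by rewrite exprS ler_piMr ?mulr_ge0 // exprn_ile1 // mulr_ge0.
Qed.

Section ExpanderProbability.
Variables (R : realType) (n : nat).
Implicit Types (S T V W X Y : {set 'I_n}) (A : {set {set 'I_n}}).

Definition cross X Y : {set {set 'I_n}} :=
  (fun uv : 'I_n * 'I_n => [set uv.1; uv.2]) @: setX X Y.

Lemma card_cross X Y : [disjoint X & Y] -> #|cross X Y| = (#|X| * #|Y|)%N.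
Proof.
move=> XY; rewrite card_in_imset ?cardsX // => -[u v] [u' v'] /=.
rewrite !inE /= => /andP[uX vY] /andP[u'X v'Y] eq.
have neq (a b : 'I_n) : a \in X -> b \in Y -> a != b.
  by move=> aX bY; apply: contraTneq bY => <-; rewrite (disjointFr XY aX).
have uu' : u = u'.
  have : u \in [set u'; v'] by rewrite -eq set21.
  by rewrite !inE (negPf (neq _ _ uX v'Y)) orbF => /eqP.
subst u'; congr pair; apply: set2_injr eq.
by rewrite eq_sym; exact: neq.
Qed.

Lemma not_expander A V : ~ expander A V -> exists S T,
  [/\ S != set0, S \subset V, (6 * #|S| <= #|V|)%N, (#|T| <= 2 * #|S|)%N &
      [disjoint A & cross S (V :\: (S :|: T))]].
Proof.
move=> nexp; apply: contrapT => nST; apply: nexp => S SV S0 S6.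
rewrite ltnNge; apply/negP => NS; apply: nST.
(* The witness [T], found by unification with [NS], is the outer neighbourhood of [S] in [V]. *)
exists S; eexists; split; [exact: S0|exact: SV|exact: S6|exact: NS|].
rewrite disjoint_sym; apply/pred0P => e; apply/negbTE/negP => /andP[/= eC eA].
case/imsetP: eC eA => -[u v] /=; rewrite !inE /= => /andP[uS /andP[]].
rewrite negb_or => /andP[vS nN] vV -> uvA; case/negP: nN.
by rewrite vV vS /=; apply/existsP; exists u; rewrite uS.
Qed.

(* The factor rho^3 pays for the choice of S and of its neighbourhood T, as
   #|T| <= 2 #|S|. *)
Lemma expander_prob (p rho : R) V W : 0 <= p <= 1 -> V \subset W ->
  0 <= rho -> n%:R ^+ 2 * rho <= 1 ->
  (forall k, (#|V| <= 2 * k)%N -> (1 - p) ^+ k <= rho ^+ 3) ->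
  EX p (inside W) (fun A => (~~ `[< expander A V >])%:R) <= 2 * (n%:R ^+ 2 * rho).
Proof.
move=> p01 VW rho0 nrho hk; have [p0 p1] := andP p01.
have rho1 : n%:R * rho <= 1.
  case: n nrho => [|m nrho]; first by rewrite mul0r.
  apply: le_trans nrho; rewrite ler_wpM2r // expr2 ler_peMr ?ler1n //.
have rho_le1 (S : {set 'I_n}) : S != set0 -> rho <= 1.
  move=> /set0Pn[s _]; apply: le_trans rho1; rewrite ler_peMl // ler1n.
  exact: leq_ltn_trans (ltn_ord s).
pose ok S T := [&& S \subset V, (6 * #|S| <= #|V|)%N & (#|T| <= 2 * #|S|)%N].
apply: (@le_trans _ _ (EX p (inside W) (fun A => \sum_(S | S != set0)
    \sum_(T | ok S T) [disjoint A & cross S (V :\: (S :|: T))]%:R))).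
  apply: ler_EX => // A _; case: asboolP => [_|/not_expander].
    by apply: sumr_ge0 => S _; apply: sumr_ge0 => T _.
  case=> S [T [S0 SV S6 T2 dis]].
  rewrite (bigD1 S) //= (bigD1 T) /=; last by rewrite /ok SV S6 T2.
  rewrite dis -addrA lerDl addr_ge0 //; first by apply: sumr_ge0.
  by apply: sumr_ge0 => S' _; apply: sumr_ge0.
rewrite EX_sum.
apply: (@le_trans _ _ (\sum_(S : {set 'I_n} | S != set0) rho ^+ #|S| *
    \sum_(T : {set 'I_n}) rho ^+ #|T|)).
  apply: ler_sum => S S0; rewrite EX_sum mulr_sumr big_mkcond /=.
  apply: ler_sum => T _; case: ifP => [/and3P[SV S6 T2]|_]; last first.
    by rewrite mulr_ge0 ?exprn_ge0.
  set Y := V :\: (S :|: T).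
  have SY : [disjoint S & Y].
    by rewrite -setI_eq0; apply/eqP/setP => t; rewrite !inE; case: (t \in S).
  apply: le_trans (EX_avoid p01 _) _.
    apply/subsetP => e /imsetP[[u v]]; rewrite !inE /= => /andP[uS vY] ->.
    have vV : v \in V by case/andP: vY.
    have := @edge_inside n u v W; rewrite !inE; apply.
    - apply: contraTneq vY => <-; by rewrite uS.
    - exact/(subsetP VW)/(subsetP SV).
    - exact: (subsetP VW).
  rewrite card_cross // mulnC exprM.
  apply: (@le_trans _ _ ((rho ^+ 3) ^+ #|S|)).
    apply: lerXn2r; rewrite ?nnegrE ?exprn_ge0 ?subr_ge0 //; apply: hk.
    (* [S] and [T] together have at most [3 * #|S|] elements, which is at most half of [V]; so [Y]
       is at least the other half. *)
    have : (#|V| <= #|Y| + (#|S| + #|T|))%N.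
      rewrite -(cardsID (S :|: T) V) addnC leq_add2l.
      by apply: leq_trans (leq_card_setU S T); apply/subset_leq_card/subsetIr.
    by move: S6 T2; clear; lia.
  rewrite -exprM -exprD; apply: ler_wiXn2l => //; first exact: rho_le1 S0.
  by move: (#|S|) (#|T|) T2 => a b; lia.
(* The double sum factors. In the sum over [T] the empty set gives 1 and the others at most 1 more,
   whence the factor 2. *)
rewrite -mulr_suml mulrC; apply: ler_pM.
- by apply: sumr_ge0 => T _; exact: exprn_ge0.
- by apply: sumr_ge0 => T _; exact: exprn_ge0.
- rewrite (bigD1 set0) //= cards0 expr0 (_ : 2 = 1 + 1 :> R) // lerD2l.
  exact: le_trans (sum_expr_card rho0 rho1) nrho.
- exact: sum_expr_card.
Qed.

(** The sum is geometric with ratio [a], and [a <= expR (- (p / 2)) <= 1 - p / 4], so it is at most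
    [p / (p / 4) = 4]. *)
Lemma geometric_mgf (p : R) m : 0 < p <= 1 ->
  \sum_(j < m) p * (1 - p) ^+ j * expR (p / 2 * j%:R) <= 4.
Proof.
move=> /andP[p0 p1].
pose a := (1 - p) * expR (p / 2).
have a0 : 0 <= a by rewrite mulr_ge0 ?expR_ge0 // subr_ge0.
have a1 : a <= 1 - p / 4.
  apply: (@le_trans _ _ (expR (- p) * expR (p / 2))).
    apply: ler_wpM2r; first exact: expR_ge0.
    exact: expR_ge1Dx.
  rewrite -expRD.
  have -> : - p + p / 2 = - (p / 2) by lra.
  have e1 := expR_ge1Dx (p / 2).
  have e0 : 0 < expR (p / 2) := expR_gt0 _.
  rewrite expRN -div1r ler_pdivrMr //.
  by nra.
rewrite (eq_bigr (fun j : 'I_m => p * a ^+ j)); last first.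
  by move=> j _; rewrite exprMn -expRM_natl [_%:R * _]mulrC mulrA.
rewrite -mulr_sumr.
have geo : (1 - a) * \sum_(j < m) a ^+ j = 1 - a ^+ m.
  by have := subrX1 a m; lra.
have : 0 <= \sum_(j < m) a ^+ j by apply: sumr_ge0 => j _; exact: exprn_ge0.
have : 0 <= a ^+ m by exact: exprn_ge0.
by move: geo; set s := \sum_(j < m) _; set t := a ^+ m; clearbody a; nra.
Qed.

End ExpanderProbability.

(** * Inversions of tuples and of sequences *)

Section InversionsSeq.
Variable n : nat.

Lemma sum_inv_seq (z : 'I_n) (s : seq 'I_n) :
  (\sum_(k < size s) \sum_(l < size s)
     ((k < l) && (nth z s l < nth z s k)) = inv_seq s)%N.
Proof.
elim: s => [|x s IH]; first by rewrite big_ord0.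
rewrite big_ord_recl big_ord_recl /= add0n; congr (_ + _)%N.
  rewrite -sum1_count [RHS]big_mkcond /= [RHS](big_nth z) [RHS]big_mkord.
  by apply: eq_bigr => l _; case: ifP.
rewrite -IH; apply: eq_bigr => k _; rewrite big_ord_recl /= add0n.
by apply: eq_bigr => l _.
Qed.

Lemma inversionsE (t : n.-tuple 'I_n) : inversions t = inv_seq t.
Proof.
have [n0|/card_gt0P[z _]] := posnP #|'I_n|.
  have -> : (t : seq _) = [::].
    by apply: size0nil; rewrite size_tuple -[LHS]card_ord.
  by apply/eqP; rewrite cards_eq0; apply/eqP/setP => -[k]; have := card0_eq n0 k.
rewrite -(sum_inv_seq z) size_tuple /inversions -sum1_card.
rewrite (eq_bigl (fun kl : 'I_n * 'I_n =>
  (kl.1 < kl.2)%N && (tnth t kl.2 < tnth t kl.1)%N)); last first.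
  by move=> kl; rewrite inE.
rewrite big_mkcond /= -(pair_big xpredT xpredT (fun k l : 'I_n =>
  if (k < l)%N && (tnth t l < tnth t k)%N then 1%N else 0%N)) /=.
apply: eq_bigr => k _; apply: eq_bigr => l _.
by rewrite !(tnth_nth z); case: ifP.
Qed.

End InversionsSeq.

(** * Hamilton cycles *)

Lemma pow_onem_le_expR (R : realType) (q a : R) k : 0 <= q <= 1 -> a <= q * k%:R ->
  (1 - q) ^+ k <= expR (- a).
Proof.
move=> /andP[q0 q1] aqk; apply: (@le_trans _ _ (expR (- q) ^+ k)).
  by rewrite lerXn2r ?nnegrE ?expR_ge0 ?subr_ge0 //; exact: expR_ge1Dx.
by rewrite -expRM_natl ler_expR; lra.
Qed.

Lemma insideT n : inside [set: 'I_n] = pairs n.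
Proof. by apply/setP => e; rewrite !inE subsetT andbT. Qed.

Section Hamilton.
Variables (R : realType) (n : nat) (z : 'I_n).
Hypothesis n_gt2 : (2 < n)%N.
Hypothesis z0 : val z = 0%N.

(** The cycle is [z], [y], then [s]. The minimal vertex [z] in front creates no inversion and [y] at
    most [n], which explains the budget [M - n]; so [y] can be any neighbour of [z]. *)
Lemma ham_ext_hamilton (y : 'I_n) (M : R) (E : {set {set 'I_n}}) : z != y ->
  [set z; y] \in E -> ham_ext z y (~: [set z; y]) (M - n%:R) E ->
  has_hamilton_cycle_inv M E.
Proof.
move=> zy zyE /asboolP[s [sU ys sz sM]].
have us : uniq s by rewrite (perm_uniq sU) enum_uniq.
have ms t : (t \in s) = (t != z) && (t != y).
  by rewrite (perm_mem sU) mem_enum !inE negb_or.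
have ssz : size s = (n - 2)%N.
  rewrite (perm_size sU) -cardE; have := cardsC [set z; y].
  by rewrite cards2 zy card_ord => /(congr1 (subn^~ 2)); rewrite addKn.
have szt : size [:: z, y & s] == n by rewrite /= ssz; apply/eqP; lia.
apply/existsP; exists (Tuple szt); apply/andP; split.
  rewrite /hamilton_cycle n_gt2 /= z0 eqxx /= !inE !ms !eqxx /= (negPf zy) andbF us /=.
  by rewrite /adj zyE rcons_path ys.
rewrite inversionsE /= natrD; move: sM; rewrite lerBrDl.
apply: le_trans; rewrite -natrD -natrD ler_nat.
have -> : count (fun t : 'I_n => (t < z)%N) s = 0%N.
  by apply/eqP; rewrite -leqn0 leqNgt -has_count; apply/hasPn => t _; rewrite [X in (_ < X)%N]z0.
have -> : (y < z)%N = false by rewrite [X in (_ < X)%N]z0.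
rewrite !add0n leq_add2r.
apply: leq_trans (count_size _ _) _; rewrite ssz; exact: leq_subr.
Qed.

(** The first graph supplies a neighbour [y] of [z], which fails with probability
    [(1 - p1) ^+ n.-1]; its pairs avoiding [z] stay fresh for expansion. The greedy phase then
    starts at [y] with [L + u] vertices left. *)
Lemma hamilton_failure_le (p1 p2 lam eta eps M : R) (L u : nat) :
  0 <= p1 <= 1 -> 0 <= p2 <= 1 -> 0 <= lam -> 0 <= eta -> 0 <= eps ->
  (forall m, \sum_(j < m) p2 * (1 - p2) ^+ j * expR (lam * j%:R) <= 4) ->
  (forall k, (L.+1 < 6 * k)%N -> (1 - p2) ^+ k <= eta) ->
  (forall x (U : {set 'I_n}), #|U| = L -> x \notin U -> z \notin x |: U ->
     EX p1 (inside (~: [set z])) (fun A => (~~ `[< expander A (x |: U) >])%:R) <= eps) ->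
  n = (L + u).+2 ->
  EX (1 - (1 - p1) * (1 - p2)) (pairs n)
    (fun E => (~~ has_hamilton_cycle_inv M E)%:R) <=
  4 ^+ u * expR (lam * ((L ^ 2)%:R - (M - n%:R))) + u%:R * (1 - p2) ^+ L
  + (eps + L.+1%:R * eta) + (1 - p1) ^+ n.-1.
Proof.
move=> p1_01 p2_01 lam0 eta0 eps0 Hmgf Heta Hexp nE.
rewrite EX_sprinkle.
pose nohc (E : {set {set 'I_n}}) : R := (~~ has_hamilton_cycle_inv M E)%:R.
have nohcS : antitone nohc.
  move=> E E' EE'; rewrite /nohc ler_nat.
  case: (boolP (has_hamilton_cycle_inv M E)) => [/existsP[s /andP[hs sM]]|_]; last first.
    by case: (~~ _).
  suff -> : has_hamilton_cycle_inv M E' by [].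
  apply/existsP; exists s; rewrite sM andbT; move: hs => /and4P[n2 us hd cy].
  apply/and4P; split=> //; apply: sub_cycle cy; exact: adjS.
have nohc1 E : nohc E <= 1 by rewrite lern1; case: has_hamilton_cycle_inv.
pose es := [seq [set z; y] | y <- enum (~: [set z])].
have -> : n.-1 = size es.
  by rewrite size_map -cardE; have := cardsC1 z; rewrite card_ord.
apply: (@EX_star_le _ _ p1 _ (inside (~: [set z]))) => //.
- move=> A A' AA'; apply: ler_EX => // B _; apply: nohcS; exact: setSU.
- move=> A; rewrite -[leRHS](EX_cst p2 (pairs n)); apply: ler_EX => // B _; exact: nohc1.
- by apply: uniq_star (enum_uniq _) _; rewrite mem_enum !inE eqxx.
- move=> e /mapP[y]; rewrite mem_enum !inE => yz ->.
  by rewrite cards2 [z == y]eq_sym yz.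
- by apply/subsetP => e; rewrite inE => /andP[].
- move=> e /mapP[y _ ->]; rewrite inE negb_and; apply/orP; right.
  by rewrite subUset !sub1set !inE eqxx.
- have [p20 p21] := andP p2_01.
  have q0 : 0 <= 1 - p2 by rewrite subr_ge0.
  by rewrite !addr_ge0 // mulr_ge0 ?expR_ge0 // exprn_ge0.
- move=> e /mapP[y]; rewrite mem_enum !inE => yz ->.
  have zy : z != y by rewrite eq_sym.
  pose U : {set 'I_n} := ~: [set z; y].
  have yU : y \notin U by rewrite !inE eqxx orbT.
  have zU : z \notin y |: U by rewrite !inE eqxx (negPf zy).
  have zyU : z |: (y |: U) = [set: 'I_n].
    by apply/setP => t; rewrite !inE; case: (t == z); case: (t == y).
  have Uu : #|U| = (L + u)%N.
    have := cardsC [set z; y]; rewrite cards2 zy card_ord -/U [RHS]nE.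
    by rewrite add2n => -[].
  have := @bad_prob_greedy R n z p1 p2 lam eta eps L _ p1_01 p2_01 lam0 eta0 eps0
    Hmgf Heta Hexp u y U (M - n%:R) Uu yU zU.
  apply: le_trans; rewrite /bad_prob zyU insideT.
  apply: ler_EX => // A _; apply: ler_EX => // B _; rewrite /nohc /bad ler_nat.
  case: (boolP (ham_ext z y U (M - n%:R) (A :|: B))) => [h|_]; last first.
    by case: (~~ _).
  have -> // : has_hamilton_cycle_inv M ([set z; y] |: A :|: B).
  apply: (@ham_ext_hamilton y) => //; first by rewrite !inE eqxx.
  by apply: ham_extS h; rewrite -setUA subsetUr.
Qed.

End Hamilton.

(** * Choice of parameters and numerical estimates *)

Lemma expR2_ge4 (R : realType) : 4 <= expR 2 :> R.
Proof.
have e1 : 2 <= expR 1 :> R by exact: (expR_ge1Dx (1 : R)).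
have -> : 2 = 1 + 1 :> R by [].
have -> : 4 = 2 * 2 :> R by rewrite -natrM.
by rewrite expRD ler_pM.
Qed.

Lemma hamilton_failure_asymptotic (R : realType) (n : nat) (p M : R) :
  (3 < n)%N -> 1 <= ln n%:R :> R -> 0 < p <= 1 ->
  100 * ln n%:R ^+ 2 <= p * n%:R -> 100 * n%:R <= p * M ->
  EX p (pairs n) (fun E => (~~ has_hamilton_cycle_inv M E)%:R) <= 6 / n%:R.
Proof.
move=> n3 l1 /andP[p0 p1] pn pM.
have n0 : 0 < n%:R :> R by rewrite ltr0n; exact: leq_trans n3.
have n4 : 4 <= n%:R :> R by rewrite (ler_nat _ 4).
set l := ln n%:R in l1 pn.
have eln : expR (- l) = n%:R^-1 by rewrite expRN lnK.
have ln_le : l <= n%:R.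
  by have := expR_ge1Dx l; rewrite lnK ?posrE //; lra.
have z_lt : (0 < n)%N by exact: leq_trans n3.
pose z := Ordinal z_lt.
(* [q2] solves [(1 - q1) * (1 - q2) = 1 - p]; both densities are at least [p / 2]. *)
pose q1 := p / 2; pose q2 := p / (2 - p).
have p2 : 2 - p != 0 by apply/eqP; lra.
have pE : p = 1 - (1 - q1) * (1 - q2) by rewrite /q1 /q2; field.
have q1_01 : 0 <= q1 <= 1 by rewrite /q1; apply/andP; split; lra.
have q2_ge : p / 2 <= q2.
  by rewrite /q2 ler_pM2l // lef_pV2 ?posrE; lra.
have q2_01 : 0 < q2 <= 1.
  apply/andP; split; first by lra.
  by rewrite /q2 ler_pdivrMr; lra.
pose la := l / p.
have pla : p * la = l by rewrite /la; field; lra.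
have la1 : 1 <= la by rewrite /la ler_pdivlMr //; lra.
(* The constant 48 makes both [q1 * L] and [q2 * L] at least [24 * l]. *)
pose L := (Num.truncn (48 * la)).+1.
have /andP[L_le L_gt] : (Num.truncn (48 * la))%:R <= 48 * la < L%:R.
  by apply: truncn_itv; lra.
have {}L_le : L%:R <= 49 * la by rewrite /L -natr1; lra.
have la_n : 100 * la <= n%:R.
  rewrite -(ler_pM2l p0); apply: le_trans pn.
  have -> : p * (100 * la) = 100 * (p * la) by ring.
  by rewrite pla; nra.
have Ln : (L.+2 <= n)%N.
  by rewrite -(ler_nat R) -addn2 natrD; lra.
have [u nE] : exists u, n = (L + u).+2 by exists (n - L.+2)%N; rewrite -!addSn subnKC.
have pL2 : p * (L ^ 2)%:R <= 25 * n%:R.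
  rewrite natrX.
  have L2 : L%:R ^+ 2 <= (49 * la) ^+ 2 :> R by rewrite lerXn2r ?nnegrE //; lra.
  (* After multiplication by [p] this compares 49 squared, which is 2401, with [25 * 100]. *)
  have : p * (49 * la) ^+ 2 <= 25 * n%:R.
    rewrite -(ler_pM2l p0).
    have -> : p * (p * (49 * la) ^+ 2) = 2401 * (p * la) ^+ 2 by ring.
    have l2 := sqr_ge0 l.
    by rewrite pla [p * _]mulrCA; lra.
  apply: le_trans; rewrite ler_pM2l //.
have q1L : 24 * l <= q1 * L%:R.
  by have := ler_wpM2l (ltW p0) (ltW L_gt); rewrite -pla /q1; move: (L%:R : R) => a; nra.
have q2L : 24 * l <= q2 * L%:R.
  by apply: le_trans q1L _; rewrite ler_wpM2r.
pose x : R := n%:R^-1.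
have x0 : 0 < x by rewrite invr_gt0.
have nx : n%:R * x = 1 by rewrite mulfV // gt_eqF.
have x1 : x <= 1 by rewrite invf_le1 //; lra.
have e4 : expR (- (4 * l)) = x ^+ 4.
  by rewrite -mulrN expRM_natl eln.
have e24 : expR (- (24 * l)) <= x ^+ 2.
  by rewrite -[x]eln -expRM_natl ler_expR; lra.
have e12 : expR (- (12 * l)) = (x ^+ 4) ^+ 3.
  by rewrite -e4 -expRM_natl; congr expR; ring.
(* A sixth of [L] gives exponent [4 * l], so [eta = x ^+ 4]; a half of [L] gives [12 * l], so the
   expansion bound applies with [rho = x ^+ 4]. *)
have := @hamilton_failure_le R n z (ltnW n3) erefl q1 q2 (q2 / 2) (x ^+ 4)
  (2 * (n%:R ^+ 2 * x ^+ 4)) M L u.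
rewrite -pE => H; apply: le_trans (H _ _ _ _ _ _ _ _ nE) _ => //.
- by case/andP: q2_01 => /ltW -> ->.
- by case/andP: q2_01 => q20 _; rewrite divr_ge0 // ltW.
- by rewrite exprn_ge0 // ltW.
- by apply: mulr_ge0 => //; apply: mulr_ge0; rewrite exprn_ge0 // ltW.
- by move=> m; exact: geometric_mgf.
- move=> k Lk; rewrite -e4; apply: pow_onem_le_expR.
    by case/andP: q2_01 => /ltW -> ->.
  have : L%:R <= 6 * k%:R :> R by rewrite -natrM ler_nat ltnW // ltnW.
  have q20 : 0 <= q2 by case/andP: q2_01 => /ltW.
  move=> /(ler_wpM2l q20)/(le_trans q2L); rewrite mulrCA.
  by move: (q2 * _) => t; clear; lra.
- move=> y U UL yU zU; apply: expander_prob => //.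
  + by apply/subsetP => t tU; rewrite !inE; apply: contraNneq zU => <-.
  + by rewrite exprn_ge0 // ltW.
  + have -> : n%:R ^+ 2 * x ^+ 4 = (n%:R * x) ^+ 2 * x ^+ 2 by ring.
    by rewrite nx expr1n mul1r exprn_ile1 // ltW.
  + move=> k; rewrite cardsU1 yU UL add1n => Lk; rewrite -e12; apply: pow_onem_le_expR => //.
    have : L%:R <= 2 * k%:R :> R by rewrite -natrM ler_nat ltnW.
    have q10 : 0 <= q1 by case/andP: q1_01.
    move=> /(ler_wpM2l q10)/(le_trans q1L); rewrite mulrCA.
    by move: (q1 * _) => t; clear; lra.
have un : u%:R <= n%:R :> R by rewrite ler_nat nE; do 2 apply: leqW; exact: leq_addl.
(* [p * D] is at most [25 n - 100 n + n = - 74 n], and [q2 / 2] is at least [p / 4], so the exponent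
   beats the [2 n] coming from [4 ^+ u] with room to spare. *)
have t1 : 4 ^+ u * expR (q2 / 2 * ((L ^ 2)%:R - (M - n%:R))) <= x.
  apply: (@le_trans _ _ (expR (2 * n%:R) * expR (- (3 * n%:R)))).
    apply: ler_pM; rewrite ?expR_ge0 ?exprn_ge0 //.
      apply: (@le_trans _ _ (expR 2 ^+ u)).
        by rewrite lerXn2r ?nnegrE ?expR_ge0 // expR2_ge4.
      by rewrite -expRM_natl ler_expR mulrC ler_pM2l.
    rewrite ler_expR; set D := (_ - (_ - _)).
    have pn1 : p * n%:R <= n%:R by rewrite ger_pMl.
    have pD : p * D <= - (74 * n%:R).
      by rewrite /D; move: pL2 pM pn1; rewrite !mulrBr; clear; lra.
    have D0 : D <= 0.
      by rewrite -(ler_pM2l p0) mulr0; move: pD n0; clear; lra.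
    have q24 : p / 4 <= q2 / 2 by move: q2_ge; clear; lra.
    have := ler_wnM2r D0 q24; rewrite [p / 4 * D]mulrAC.
    by move: (q2 / 2 * D) (p * D) pD n0 => t t'; clear; lra.
  by rewrite -expRD /x -eln ler_expR; move: ln_le; clear; lra.
have t2 : u%:R * (1 - q2) ^+ L <= x.
  apply: (@le_trans _ _ (n%:R * x ^+ 2)); last by rewrite expr2 mulrA nx mul1r.
  have q2' : 0 <= q2 <= 1 by case/andP: q2_01 => /ltW -> ->.
  apply: ler_pM => //; first by rewrite exprn_ge0 // subr_ge0; case/andP: q2_01.
  by apply: le_trans e24; exact: pow_onem_le_expR.
have x2 : x ^+ 2 <= x by rewrite expr2 ger_pMl.
have t3 : 2 * (n%:R ^+ 2 * x ^+ 4) <= 2 * x.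
  have -> : n%:R ^+ 2 * x ^+ 4 = (n%:R * x) ^+ 2 * x ^+ 2 by ring.
  by rewrite nx expr1n mul1r ler_pM2l.
have t4 : L.+1%:R * x ^+ 4 <= x.
  apply: (@le_trans _ _ (n%:R * x ^+ 4)).
    by rewrite ler_wpM2r ?exprn_ge0 ?(ltW x0) // ler_nat ltnW.
  have -> : n%:R * x ^+ 4 = (n%:R * x) * (x ^+ 2 * x) by ring.
  by rewrite nx mul1r ger_pMl // (le_trans x2).
have t5 : (1 - q1) ^+ n.-1 <= x.
  apply: le_trans x2; apply: le_trans e24; apply: pow_onem_le_expR => //.
  apply: le_trans q1L _; apply: ler_wpM2l; first by case/andP: q1_01.
  by rewrite ler_nat nE; apply/leqW/leq_addr.
(* The five bounds add up to [(1 + 1 + 2 + 1 + 1) * x = 6 * x]. *)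
rewrite -/x; move: t1 t2 t3 t4 t5.
move: (4 ^+ u * _) (u%:R * _) (2 * (_ * _)) (L.+1%:R * _) (_ ^+ n.-1).
by clear; move=> *; lra.
Qed.

(** * From the failure bound to the limit *)

Lemma gnp_prob_EX (R : realType) (n : nat) (p : R) (A : pred {set {set 'I_n}}) :
  gnp_prob p A = 1 - EX p (pairs n) (fun E => (~~ A E)%:R).
Proof.
rewrite -[X in X - _](EX_cst p (pairs n)) -mulN1r -EX_Z -EX_D.
rewrite /gnp_prob /EX big_mkcondr; apply: eq_bigr => E _.
rewrite /gnp_weight mulN1r; case: (A E) => /=; first by rewrite subr0 mulr1.
by rewrite subrr mulr0.
Qed.

Local Open Scope classical_set_scope.
Local Open Scope ring_scope.

Theorem theorem8 (R : realType) (K : R) (M p : nat -> R)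
    (hK : 0 < K)
    (hM0 : \forall n \near \oo, 0 < M n)
    (hM : \forall n \near \oo, M n <= K * n%:R ^+ 2 / ln (n%:R : R) ^+ 2)
    (hp01 : \forall n \near \oo, 0 <= p n <= 1)
    (hp : \forall n \near \oo, 100 * Num.max K 1 * n%:R / M n <= p n) :
  @gnp_prob R n (p n) (@has_hamilton_cycle_inv R n (M n)) @[n --> \oo]
    --> (1 : R).
Proof.
apply/cvgrPdist_le => /= e e0; near=> n.
have n3 : (3 < n)%N by near: n; exact: nbhs_infty_gt.
have n0 : 0 < n%:R :> R by rewrite ltr0n; exact: leq_trans n3.
have l1 : 1 <= ln n%:R :> R.
  rewrite -[leLHS]expRK ler_ln ?posrE ?expR_gt0 //.
  by near: n; exact: nbhs_infty_ger.
have M0 : 0 < M n by near: n.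
have Mn : M n <= K * n%:R ^+ 2 / ln n%:R ^+ 2 by near: n.
have /andP[p0 p1] : 0 <= p n <= 1 by near: n.
have pn : 100 * Num.max K 1 * n%:R / M n <= p n by near: n.
have ne : 6 / e <= n%:R by near: n; exact: nbhs_infty_ger.
(* The maximum acts twice: its bound by 1 gives [100 n <= p M], its bound by [K] gives the lower
   bound on [p n]. *)
have maxK : K <= Num.max K 1 by rewrite le_max lexx.
have max1 : 1 <= Num.max K 1 by rewrite le_max lexx orbT.
have pM : 100 * Num.max K 1 * n%:R <= p n * M n by rewrite -ler_pdivrMr.
have l2 : 0 < ln n%:R ^+ 2 :> R by rewrite exprn_gt0 // (lt_le_trans _ l1).
have pM1 : 100 * n%:R <= p n * M n.
  by apply: le_trans pM; rewrite ler_pM2r // ler_peMr.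
have pgt0 : 0 < p n.
  by rewrite -(ltr_pM2r M0) mul0r; apply: lt_le_trans pM1; rewrite mulr_gt0.
(* Combines [100 K n <= p M] with [M * ln n ^ 2 <= K n ^ 2]; the factor [K n] cancels. *)
have pnl : 100 * ln n%:R ^+ 2 <= p n * n%:R.
  have Kn : 0 < K * n%:R by rewrite mulr_gt0.
  rewrite -(ler_pM2l Kn).
  apply: (@le_trans _ _ (p n * M n * ln n%:R ^+ 2)).
    rewrite mulrA ler_pM2r //; apply: le_trans pM.
    by rewrite [leLHS]mulrC mulrA ler_pM2r // ler_pM2l.
  move: Mn; rewrite ler_pdivlMr // => /(ler_wpM2l p0); rewrite mulrA => /le_trans; apply.
  by rewrite le_eqVlt; apply/orP; left; apply/eqP; ring.
have fail := hamilton_failure_asymptotic n3 l1 (introT andP (conj pgt0 p1)) pnl pM1.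
rewrite gnp_prob_EX opprB addrC subrK ger0_norm; last first.
  rewrite -(EX_cst (p n) (pairs n) 0); apply: ler_EX => [|E _]; first by rewrite p0.
  by [].
apply: le_trans fail _; rewrite ler_pdivrMr // mulrC -ler_pdivrMr //.
Unshelve. all: by end_near.
Qed.
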